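(* All zeros of the vector field $\xi$ on $\mathbb{R}_*^{n\times p}/\mathrm{O}_p$ induced by the projected Oja vector field are nondegenerate. Explicitly: let $X_*\in\mathbb{R}_*^{n\times p}$ satisfy $\overline{\xi}_{X_*}=0$, where $\overline{\xi}_X:=P^{\mathrm h}_X(F(X))$. Then the linear operator $$\mathcal{H}_{X_*}\to\mathcal{H}_{X_*}:\quad Z\mapsto P^{\mathrm h}_{X_*}\big(\mathrm{D}\overline{\xi}(X_* )[Z]\big)$$ is nonsingular (invertible).
   Context: Standing assumptions: $n,p$ are positive integers with $p<n$, and $A$ is a real symmetric positive-definite $n\times n$ matrix whose eigenvalues are all simple, $\lambda_1>\cdots>\lambda_n$. Notation: $\mathbb{R}_*^{n\times p}=\{X\in\mathbb{R}^{n\times p}:\det(X^TX)\neq 0\}$, an open subset of $\mathbb{R}^{n\times p}$; $\mathrm{O}_p=\{Q\in\mathbb{R}^{p\times p}:Q^TQ=I\}$, acting on $\mathbb{R}_*^{n\times p}$ by $X\mapsto XQ$; for a square matrix $B$, $\mathrm{skew}(B)=\tfrac12(B-B^T)$. Oja's vector field is $F:\mathbb{R}^{n\times p}\to\mathbb{R}^{n\times p}$, $F(X)=AX-XX^TAX$. For $X\in\mathbb{R}_*^{n\times p}$, $P^{\mathrm h}_X:\mathbb{R}^{n\times p}\to\mathbb{R}^{n\times p}$ is the linear map $P^{\mathrm h}_X(Z)=Z-X\,\mathrm{skew}\big((X^TX)^{-1}X^TZ\big)$, and its image is the horizontal space $\mathcal{H}_X=\mathrm{im}(P^{\mathrm h}_X)=\{XS+X_\perp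 K: S\in\mathbb{R}^{p\times p},\,S^T=S,\ K\in\mathbb{R}^{(n-p)\times p}\}$, where $X_\perp\in\mathbb{R}^{n\times(n-p)}$ is any matrix with orthonormal columns satisfying $X^TX_\perp=0$. The map $X\mapsto\overline{\xi}_X=P^{\mathrm h}_X(F(X))$ is a smooth map $\mathbb{R}_*^{n\times p}\to\mathbb{R}^{n\times p}$, and $\mathrm{D}\overline{\xi}(X)[Z]$ denotes its directional derivative at $X$ along $Z\in\mathbb{R}^{n\times p}$. It is the horizontal lift of a vector field $\xi$ on the quotient manifold $\mathbb{R}_*^{n\times p}/\mathrm{O}_p$, whose zeros are the classes $X\mathrm{O}_p$ with $\overline{\xi}_X=0$. The Jacobian of $\xi$ at such a class (with respect to the affine connection $\nabla$ whose horizontal lift is $\overline{(\nabla_\eta\xi)}_X=P^{\mathrm h}_X\mathrm{D}\overline{\xi}(X)[\overline{\eta}_X]$) is represented by the operator displayed in the claim; a zero of $\xi$ is called nondegenerate if this operator is nonsingular. *)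

(* Defs.v *)
From HB Require Import structures.
From mathcomp Require Export all_boot all_order all_algebra.
From mathcomp Require Export all_classical all_reals all_analysis.

Set Implicit Arguments.
Unset Strict Implicit.
Unset Printing Implicit Defensive.

Import Order.TTheory GRing.Theory Num.Theory.
Import numFieldNormedType.Exports.

Local Open Scope classical_set_scope.
Local Open Scope ring_scope.

Definition posdefmx (R : realType) n (A : 'M[R]_n) : Prop :=
  forall x : 'cV[R]_n, x != 0 -> 0 < (x^T *m A *m x) 0 0.

Definition fullrank_mxs (R : realType) n p : set 'M[R]_(n, p) :=
  [set X | \det (X^T *m X) != 0].

Definition skew (R : realType) p (B : 'M[R]_p) : 'M[R]_p :=
  2^-1 *: (B - B^T).

Definition oja (R : realType) n p (A : 'M[R]_n) (X : 'M[R]_(n, p)) :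
    'M[R]_(n, p) :=
  A *m X - X *m X^T *m A *m X.

(* Only meaningful for X in fullrank_mxs: elsewhere invmx (X^T *m X) is
   X^T *m X itself. *)
Definition hproj (R : realType) n p (X Z : 'M[R]_(n, p)) : 'M[R]_(n, p) :=
  Z - X *m skew (invmx (X^T *m X) *m X^T *m Z).

Definition hspace (R : realType) n p (X : 'M[R]_(n, p)) : set 'M[R]_(n, p) :=
  range (hproj X).

(* The horizontal lift of the vector field on the quotient by O_p. It is a
   total function, but fullrank_mxs is open, so its derivative at a point of
   fullrank_mxs only depends on its values there. *)
Definition oja_lift (R : realType) n p (A : 'M[R]_n) (X : 'M[R]_(n, p)) :
    'M[R]_(n, p) :=
  hproj X (oja A X).

(* L restricts to an invertible linear operator H -> H, for H a linear
   subspace of V. *)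
Definition nonsingular_on (R : realType) (V : lmodType R) (H : set V)
    (L : V -> V) : Prop :=
  (forall (a : R) (Z W : V), H Z -> H W -> L (a *: Z + W) = a *: L Z + L W) /\
  set_bij H H L.

(* Main.v *)
From HB Require Import structures.
Require Import Defs.
From mathcomp Require Import all_boot all_order all_algebra.
From mathcomp Require Import all_classical all_reals all_analysis.

Set Implicit Arguments.
Unset Strict Implicit.
Unset Printing Implicit Defensive.

Import Order.TTheory GRing.Theory Num.Theory.
Import numFieldNormedType.Exports.

Local Open Scope classical_set_scope.
Local Open Scope ring_scope.

(** A zero of the lifted field is an orthonormal basis of an invariant subspace
of [A], and there the Jacobian splits into two Sylvester operators.

Put [M = X^T A X], [G = X^T X] and [F = oja A X].  Since [X^T F = M - G M],
the equation [F = X skew (G^-1 X^T F)], multiplied by [G^-1 X^T], says that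
[G^-1 M - M] is skew-symmetric, that is
[(G^-1 - 1) M + M (G^-1 - 1) = 0].  As [M] is positive definite this forces
[G = 1]; the skew part then vanishes and [F = 0], i.e. [A X = X M]
([oja_lift_zero]).

At such a point the correction term of [hproj] is [X] times the skew part of
a function vanishing at [X]; its derivative is [X] times a skew-symmetric
matrix, which [hproj X] kills.  The derivative of the inverse Gram matrix is
therefore never computed, only its existence matters ([oja_lift_derive]),
and the Jacobian is [hproj X] applied to
[oja_jac Z = A Z - Z M - X (Z^T A X + X^T A Z)] ([hproj_derive]).

For a horizontal [Z] the matrix [S = X^T Z] is symmetric.  If the Jacobian
kills [Z], its component along [X] gives [M S + S M = 0], so [S = 0], and the
rest gives [A Z = Z M].  Then [Z X^T] commutes with [A] and squares to zero;
since the eigenvalues of [A] are simple, [Z X^T = 0] and so [Z = 0]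
([oja_jac_inj]).  Finite dimension turns injectivity on the horizontal space
into bijectivity ([proj_inj_bij]). *)

(* The short name also denotes a notation of sesquilinear forms. *)
Local Notation skew := Defs.skew.

(** * Directional derivatives of matrix-valued functions *)

Section MatrixCurves.
Context {R : realType}.

Lemma is_derive_line (V W : normedModType R) (f : V -> W) (x v : V) (df : W) :
  is_derive x v f df <-> is_derive (0 : R) 1 (fun h => f (h *: v + x)) df.
Proof.
have eqD : 'D_v f x = 'D_1 (fun h : R => f (h *: v + x)) 0.
  rewrite /derive; set q := fun h => _; set q' := fun h => _.
  suff -> : q = q' by []; apply/funext => h; rewrite /q /q' /=.
  by rewrite scale0r add0r addr0 [_%:A]mulr1.
by split=> -[dfx <-]; split; rewrite ?eqD//; apply/(derivable1P f x v).
Qed.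

Lemma is_derive_mxP (V : normedModType R) m n (M : V -> 'M[R]_(m, n))
    (x v : V) (dM : 'M[R]_(m, n)) :
  is_derive x v M dM <->
  forall i j, is_derive x v (fun y => M y i j) (dM i j).
Proof.
split=> [[dMx dME] i j|dMx].
  split; first exact: (derivable_mxP M x v).1.
  by move/(congr1 (fun B : 'M[R]_(m, n) => B i j)): dME; rewrite derive_mx// mxE.
have Mx : derivable M x v by apply/derivable_mxP => i j; case: (dMx i j).
split=> //; rewrite derive_mx//; apply/matrixP => i j; rewrite mxE.
exact: derive_val.
Qed.

Lemma is_derive_mulmx (V : normedModType R) m n p (f : V -> 'M[R]_(m, n))
    (g : V -> 'M[R]_(n, p)) (x v : V) df dg :
  is_derive x v f df -> is_derive x v g dg ->
  is_derive x v (fun y => f y *m g y) (df *m g x + f x *m dg).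
Proof.
move=> /is_derive_mxP f' /is_derive_mxP g'; apply/is_derive_mxP => i j.
have -> : (fun y => (f y *m g y) i j) =
    \sum_(k < n) ((fun y => f y i k) * (fun y => g y k j)).
  by apply/funext => y; rewrite mxE fct_sumE.
apply: is_derive_eq; rewrite !mxE -big_split/=; apply: eq_bigr => k _.
by rewrite addrC; congr (_ + _); exact: mulrC.
Qed.

Lemma is_derive_trmx (V : normedModType R) m n (f : V -> 'M[R]_(m, n))
    (x v : V) df :
  is_derive x v f df -> is_derive x v (fun y => (f y)^T) df^T.
Proof.
move=> /is_derive_mxP f'; apply/is_derive_mxP => i j; rewrite mxE.
by under eq_fun do rewrite mxE.
Qed.

Lemma is_derive_skew (V : normedModType R) n (f : V -> 'M[R]_n) (x v : V) df :
  is_derive x v f df -> is_derive x v (fun y => skew (f y)) (skew df).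
Proof.
move=> f'; rewrite /skew; apply: is_deriveZ; apply: is_deriveB.
exact: is_derive_trmx.
Qed.

Lemma derivable_bigsum (V : normedModType R) (I : Type) (r : seq I)
    (P : pred I) (F : I -> V -> R) (x v : V) :
  (forall i, derivable (F i) x v) ->
  derivable (fun y => \sum_(i <- r | P i) F i y) x v.
Proof.
move=> dF; elim: r => [|i r IHr].
  by under eq_fun do rewrite big_nil; exact: derivable_cst.
under eq_fun do rewrite big_cons; case: (P i) => //.
exact: derivableD.
Qed.

Lemma derivable_bigprod (V : normedModType R) (I : Type) (r : seq I)
    (P : pred I) (F : I -> V -> R) (x v : V) :
  (forall i, derivable (F i) x v) ->
  derivable (fun y => \prod_(i <- r | P i) F i y) x v.
Proof.
move=> dF; elim: r => [|i r IHr].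
  by under eq_fun do rewrite big_nil; exact: derivable_cst.
under eq_fun do rewrite big_cons; case: (P i) => //.
exact: derivableM.
Qed.

Lemma derivable_det (V : normedModType R) n (M : V -> 'M[R]_n) (x v : V) :
  derivable M x v -> derivable (fun y => \det (M y)) x v.
Proof.
move=> /derivable_mxP dM; apply: derivable_bigsum => s.
apply: derivableM; first exact: derivable_cst.
exact: derivable_bigprod.
Qed.

(** By Cramer's rule the inverse is, near an invertible matrix, a rational
function of the entries.  The variable is real because a directional
derivative alone does not make the determinant continuous, hence nonzero
nearby, on a space of higher dimension. *)
Lemma derivable_invmx n (M : R -> 'M[R]_n) (x : R) :
  derivable M x 1 -> M x \in unitmx -> derivable (fun y => invmx (M y)) x 1.
Proof.
move=> dM; rewrite unitmxE unitfE => Mx_unit.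
have ddet := derivable_det dM.
have det_cont : {for x, continuous (fun y => \det (M y))}.
  exact/differentiable_continuous/derivable1_diffP.
apply: (@near_eq_derivable _ _ _ (fun y => (\det (M y))^-1 *: \adj (M y))).
  near=> y; rewrite /invmx unitmxE unitfE ifT//.
  by near: y; exact: (cvgr_neq0 _ det_cont).
apply/derivable_mxP => i j; under eq_fun do rewrite !mxE.
apply: derivableM; first exact: derivableV.
apply: derivableM; first exact: derivable_cst.
apply: derivable_det; apply/derivable_mxP => k l.
under eq_fun do rewrite !mxE.
exact: (derivable_mxP M x 1).1.
Unshelve. all: by end_near. Qed.

End MatrixCurves.

(** * Linear algebra *)

(** Extending [L] by the identity on the kernel of [P] gives an injective, hence
surjective, endomorphism of the whole space. *)
Lemma proj_inj_bij (F : fieldType) (V : vectType F) (P L : {linear V -> V}) :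
  (forall z, P (P z) = P z) -> (forall z, P (L z) = L z) ->
  (forall z, P z = z -> L z = 0 -> z = 0) ->
  set_bij (range P) (range P) L.
Proof.
move=> PP PL Linj; split.
- by move=> _ [z _ <-]; exists (L (P z)).
- move=> _ _ /set_mem[z _ <-] /set_mem[w _ <-] eqL; apply/eqP.
  rewrite -subr_eq0; apply/eqP/Linj; first by rewrite linearB /= !PP.
  by rewrite linearB /= eqL subrr.
pose f := (linfun L \o linfun P + (\1 - linfun P))%VF.
have fE z : f z = L (P z) + (z - P z).
  by rewrite add_lfunE comp_lfunE add_lfunE opp_lfunE id_lfunE !lfunE.
have Pf z : P (f z) = L (P z).
  by rewrite fE linearD linearB /= PP PL subrr addr0.
have f_inj : lker f == 0%VS.
  apply/lker0P => z w eqf; apply/eqP; rewrite -subr_eq0; apply/eqP.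
  have f0 : f (z - w) = 0 by rewrite linearB/= eqf subrr.
  have P0 : P (z - w) = 0 by apply: Linj; rewrite ?PP// -Pf f0 linear0.
  by rewrite -f0 fE P0 linear0 subr0 add0r.
move=> _ [z _ <-].
exists (P (f^-1%VF (P z))); first by exists (f^-1%VF (P z)).
by rewrite -Pf lker0_lfunVK.
Qed.

(** The trace is the sum of the values of the form [M] on the columns of [S]. *)
Lemma mxtrace_posdef_eq0 (R : realType) n m (M : 'M[R]_n) (S : 'M[R]_(n, m)) :
  posdefmx M -> \tr (S^T *m M *m S) = 0 -> S = 0.
Proof.
move=> Mpos trS.
have colE i : (S^T *m M *m S) i i = ((col i S)^T *m M *m col i S) 0 0.
  by rewrite tr_col -row_mul !mxE; apply: eq_bigr => k _; rewrite !mxE.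
have ge0 i : 0 <= (S^T *m M *m S) i i.
  rewrite colE; have [->|/Mpos/ltW//] := eqVneq (col i S) 0.
  by rewrite mulmx0 mxE.
apply/matrixP => k i; rewrite mxE.
have : (S^T *m M *m S) i i = 0.
  apply/eqP; move/eqP: trS; rewrite psumr_eq0// => /allP; apply.
  by rewrite mem_index_enum.
rewrite colE; have [/matrixP/(_ k 0)|/Mpos/[swap] ->] := eqVneq (col i S) 0.
  by rewrite !mxE.
by rewrite ltxx.
Qed.

(** [tr (S M S)] equals both [tr (M S S)] and its opposite. *)
Lemma sylvester_sym_eq0 (R : realType) n (M S : 'M[R]_n) :
  posdefmx M -> S^T = S -> M *m S + S *m M = 0 -> S = 0.
Proof.
move=> Mpos Ssym /eqP; rewrite addr_eq0 => /eqP MS.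
apply: (mxtrace_posdef_eq0 Mpos); rewrite Ssym.
have : \tr (S *m M *m S) = - \tr (S *m M *m S).
  by rewrite -[in LHS]mulmxA MS mulmxN linearN/= mxtrace_mulC.
by move/eqP; rewrite -addr_eq0 -mulr2n mulrn_eq0 => /eqP.
Qed.

Lemma posdef_congr (R : realType) n p (A : 'M[R]_n) (X : 'M[R]_(n, p)) :
  posdefmx A -> fullrank_mxs X -> posdefmx (X^T *m A *m X).
Proof.
move=> Apos Xfull x x_neq0.
have /Apos : X *m x != 0.
  apply: contra_neq x_neq0 => Xx0.
  have XX : X^T *m X \in unitmx by rewrite unitmxE unitfE.
  by rewrite -[x](mulKmx XX) -mulmxA Xx0 !mulmx0.
by rewrite trmx_mul !mulmxA.
Qed.

(** The [n] eigenspaces are in direct sum, so they are lines and span the whole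
space.  Each is stable under [N], which acts on it by a scalar of square
zero. *)
Lemma simple_spectrum_comm_nilp (F : fieldType) n (A N : 'M[F]_n)
    (lam : 'I_n -> F) :
  injective lam -> (forall i, eigenvalue A (lam i)) ->
  A *m N = N *m A -> N *m N = 0 -> N = 0.
Proof.
move=> lam_inj lam_eig AN NN.
pose E i := eigenspace A (lam i).
have E_gt0 i : (0 < \rank (E i))%N by rewrite lt0n mxrank_eq0; exact: lam_eig.
have dxE : mxdirect (\sum_i E i).
  by apply: mxdirect_sum_eigenspace => i j _ _ /lam_inj.
have rkE : (\sum_i \rank (E i) = \rank (\sum_i E i)%MS)%N.
  by apply/esym/mxdirectP.
have le_n : (\sum_i \rank (E i) <= n)%N by rewrite rkE rank_leq_row.
have ge_n : (n <= \sum_i \rank (E i))%N.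
  rewrite -[X in (X <= _)%N]card_ord -sum1_card; exact: leq_sum.
have rk1 i : \rank (E i) = 1%N.
  apply/eqP; rewrite eqn_leq E_gt0 andbT leqNgt; apply/negP => gt1.
  move: le_n; rewrite leqNgt => /negP; apply.
  rewrite -[X in (X < _)%N]card_ord -sum1_card (bigD1 i)//=.
  rewrite [X in (_ < X)%N](bigD1 i)//=.
  by rewrite -addSn leq_add// leq_sum.
have full : (1%:M <= \sum_i E i)%MS.
  by rewrite sub1mx /row_full -rkE eqn_leq le_n.
suff : (1%:M <= kermx N)%MS by rewrite sub_kermx mul1mx => /eqP.
apply: submx_trans full _; apply/sumsmx_subP => i _.
rewrite -(eq_row_base (E i)).
move: (row_base _) (eq_row_base (E i)); rewrite rk1 => v vE.
have vA : v *m A = lam i *: v by apply/eigenspaceP; rewrite vE.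
have /sub_rVP[a vN] : (v *m N <= v)%MS.
  rewrite vE; apply/eigenspaceP.
  by rewrite -mulmxA -AN mulmxA vA scalemxAl.
rewrite sub_kermx vN.
have : v *m N *m N = 0 by rewrite -mulmxA NN mulmx0.
rewrite vN -scalemxAl vN scalerA => /eqP.
rewrite scaler_eq0 mulf_eq0 orbb => /orP[/eqP ->|/eqP ->].
  by rewrite scale0r.
by rewrite scaler0.
Qed.

(** * The horizontal projection at an orthonormal frame *)

Section HorizontalProjection.
Context {R : realType}.

Lemma skew_is_linear n : linear (@Defs.skew R n).
Proof.
move=> a B C; rewrite /skew linearP/= opprD addrACA -scalerBr scalerDr.
by rewrite !scalerA [2^-1 * a]mulrC.
Qed.

HB.instance Definition _ n :=
  GRing.isLinear.Build R _ _ _ (@Defs.skew R n) (@skew_is_linear n).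

Lemma trmx_skew n (B : 'M[R]_n) : (skew B)^T = - skew B.
Proof. by rewrite /skew linearZ linearB/= trmxK -scalerN opprB. Qed.

Lemma skew_sym n (B : 'M[R]_n) : B^T = B -> skew B = 0.
Proof. by move=> Bsym; rewrite /skew Bsym subrr scaler0. Qed.

Lemma skew_asym n (B : 'M[R]_n) : B^T = - B -> skew B = B.
Proof.
move=> Basym; rewrite /skew Basym opprK -mulr2n -[B *+ 2]scaler_nat scalerA.
by rewrite mulVf ?scale1r// pnatr_eq0.
Qed.

Lemma skew_eq0 n (B : 'M[R]_n) : skew B = 0 -> B^T = B.
Proof.
move/eqP; rewrite /skew scaler_eq0 invr_eq0 pnatr_eq0/= subr_eq0.
by move=> /eqP.
Qed.

Lemma hproj_is_linear n p (X : 'M[R]_(n, p)) : linear (hproj X).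
Proof.
move=> a Z W; rewrite /hproj !linearP/=.
by rewrite addrACA -scalerDr.
Qed.

HB.instance Definition _ n p (X : 'M[R]_(n, p)) :=
  GRing.isLinear.Build R _ _ _ (hproj X) (hproj_is_linear X).

Lemma hproj_orthoE n p (X Z : 'M[R]_(n, p)) :
  X^T *m X = 1%:M -> hproj X Z = Z - X *m skew (X^T *m Z).
Proof. by move=> XX; rewrite /hproj XX invmx1 mul1mx. Qed.

Lemma hproj_vertical n p (X : 'M[R]_(n, p)) (B : 'M[R]_p) :
  X^T *m X = 1%:M -> hproj X (X *m skew B) = 0.
Proof.
move=> XX; rewrite hproj_orthoE// mulmxA XX mul1mx.
by rewrite (skew_asym (trmx_skew B)) subrr.
Qed.

Lemma hproj_id n p (X Z : 'M[R]_(n, p)) :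
  X^T *m X = 1%:M -> hproj X (hproj X Z) = hproj X Z.
Proof.
move=> XX; rewrite [in X in hproj _ X = _]hproj_orthoE//.
by rewrite linearB/= hproj_vertical// subr0.
Qed.

(** Multiplied by [X^T], the hypothesis says that [skew (X^T *m Z)] is zero. *)
Lemma hproj_fix_sym n p (X Z : 'M[R]_(n, p)) :
  X^T *m X = 1%:M -> hproj X Z = Z -> (X^T *m Z)^T = X^T *m Z.
Proof.
move=> XX; rewrite hproj_orthoE// => /(congr1 (mulmx X^T)).
rewrite mulmxBr mulmxA XX mul1mx => /eqP; rewrite subr_eq addrC -subr_eq subrr.
by rewrite eq_sym => /eqP/skew_eq0.
Qed.

End HorizontalProjection.

(** * Zeros of the lifted Oja field and its Jacobian there *)

Section Oja.
Context {R : realType} {n p : nat}.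
Context (A : 'M[R]_n) (A_sym : A^T = A) (A_pos : posdefmx A).

(** Multiplying the equation by [invmx (X^T *m X) *m X^T] shows that
[invmx (X^T *m X) - 1%:M] solves a homogeneous Sylvester equation with
positive definite coefficient. *)
Lemma oja_lift_zero (X : 'M[R]_(n, p)) :
  fullrank_mxs X -> oja_lift A X = 0 -> X^T *m X = 1%:M /\ oja A X = 0.
Proof.
move=> Xfull; rewrite /oja_lift /hproj.
set F := oja A X; set G := X^T *m X; set H := invmx G.
have Gu : G \in unitmx by rewrite unitmxE unitfE.
pose M := X^T *m A *m X.
have Mpos : posdefmx M by exact: posdef_congr.
have Msym : M^T = M by rewrite /M !trmx_mul trmxK A_sym mulmxA.
have Hsym : H^T = H by rewrite /H trmx_inv /G trmx_mul trmxK.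
have HXF : H *m X^T *m F = H *m M - M.
  rewrite /F /oja mulmxBr; congr (_ - _); first by rewrite /M !mulmxA.
  rewrite -!mulmxA [X^T *m (X *m _)]mulmxA -/G mulKmx//.
  by rewrite /M !mulmxA.
rewrite HXF => /eqP; rewrite subr_eq0 => /eqP Fvert.
have eqS : H *m M - M = skew (H *m M - M).
  by rewrite -{1}HXF {1}Fvert -mulmxA [X^T *m _]mulmxA -/G mulKmx.
have : (H *m M - M)^T = - (H *m M - M) by rewrite {1}eqS trmx_skew -eqS.
rewrite linearB /= trmx_mul Msym Hsym => eqMH.
have H1 : H - 1%:M = 0.
  apply: (sylvester_sym_eq0 Mpos); first by rewrite linearB/= trmx1 Hsym.
  by rewrite mulmxBr mulmxBl mulmx1 mul1mx eqMH addNr.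
have {}H1 : H = 1%:M by apply/eqP; rewrite -subr_eq0 H1.
have G1 : G = 1%:M by rewrite -[G]invmxK -/H H1 invmx1.
by split=> //; rewrite Fvert H1 mul1mx subrr skew_sym ?mulmx0// trmx0.
Qed.

Context (X : 'M[R]_(n, p)) (X_orth : X^T *m X = 1%:M) (X_zero : oja A X = 0).
Let M := X^T *m A *m X.

Lemma oja_zeroE : A *m X = X *m M.
Proof. by move/eqP: X_zero; rewrite subr_eq0 /M !mulmxA => /eqP. Qed.

Lemma oja_zero_trE : X^T *m A = M *m X^T.
Proof.
have /(congr1 trmx) := oja_zeroE.
by rewrite !trmx_mul A_sym trmxK /M !mulmxA.
Qed.

(** The derivative of [oja A] at [X] in the direction [Z]. *)
Definition oja_jac (Z : 'M[R]_(n, p)) : 'M[R]_(n, p) :=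
  A *m Z - (Z *m M + X *m (Z^T *m A *m X + X^T *m A *m Z)).

(** The correction term of [oja_lift] is [X] times the skew part of
[invmx (X^T *m X) *m X^T *m oja A X], which is zero at [X]: only the
derivative [B] of that factor contributes. *)
Lemma oja_lift_derive (Z : 'M[R]_(n, p)) :
  exists B, 'D_Z (oja_lift A) X = oja_jac Z - X *m skew B.
Proof.
pose c (h : R) := h *: Z + X.
have c0 : c 0 = X by rewrite /c scale0r add0r.
have dc : is_derive (0 : R) 1 c Z.
  exact: (is_derive_line id X Z Z).1 (is_derive_id X Z).
have dcT := is_derive_trmx dc.
have dconst m q (B : 'M[R]_(m, q)) : is_derive (0 : R) 1 (fun=> B) 0.
  exact: is_derive_cst.
have doja : is_derive (0 : R) 1 (fun h => oja A (c h)) (oja_jac Z).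
  rewrite /oja; apply: is_derive_eq.
    apply: is_deriveB; first exact: is_derive_mulmx.
    apply: is_derive_mulmx => //; apply: is_derive_mulmx => //.
    exact: is_derive_mulmx.
  rewrite /= c0 !mul0mx !mulmx0 !add0r addr0 /oja_jac /M mulmxDr.
  by rewrite !mulmxDl !mulmxA addrA.
have dinv : derivable (fun h => invmx ((c h)^T *m c h)) (0 : R) 1.
  apply: derivable_invmx; last by rewrite c0 X_orth unitmx1.
  by case: (is_derive_mulmx dcT dc).
have [dW W'] : exists dW, is_derive (0 : R) 1
    (fun h => invmx ((c h)^T *m c h) *m (c h)^T *m oja A (c h)) dW.
  by eexists; exact: is_derive_mulmx (is_derive_mulmx (derivableP dinv) dcT) doja.
exists dW.
have dlift := is_deriveB doja (is_derive_mulmx dc (is_derive_skew W')).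
have {}dlift := (is_derive_line (oja_lift A) X Z _).2 dlift.
rewrite derive_val c0 X_zero mulmx0.
by rewrite [in Z *m _]skew_sym ?trmx0// mulmx0 add0r.
Qed.

Lemma hproj_derive (Z : 'M[R]_(n, p)) :
  hproj X ('D_Z (oja_lift A) X) = hproj X (oja_jac Z).
Proof.
have [B ->] := oja_lift_derive Z.
by rewrite linearB/= hproj_vertical// subr0.
Qed.

Lemma oja_jac_is_linear : linear oja_jac.
Proof.
move=> a Z W; rewrite /oja_jac !(linearP, mulmxDl, mulmxDr) /=.
rewrite -!scalemxAl -!scalemxAr.
rewrite scalerBr !scalerDr [X in _ - (_ + X)]addrACA [X in _ - X]addrACA.
by rewrite opprD addrACA.
Qed.

HB.instance Definition _ :=
  GRing.isLinear.Build R _ _ _ oja_jac oja_jac_is_linear.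

(** The part of the equation along [X] is a Sylvester equation for [X^T *m Z];
once this is zero, [Z *m X^T] commutes with [A] and is nilpotent. *)
Lemma oja_jac_inj (lam : 'I_n -> R) (Z : 'M[R]_(n, p)) :
  injective lam -> (forall i, eigenvalue A (lam i)) ->
  hproj X Z = Z -> hproj X (oja_jac Z) = 0 -> Z = 0.
Proof.
move=> lam_inj lam_eig /(hproj_fix_sym X_orth).
set S := X^T *m Z => Ssym; rewrite hproj_orthoE// => /eqP.
rewrite subr_eq0 => /eqP jacZ.
have Mpos : posdefmx M.
  by apply: posdef_congr => //; rewrite /fullrank_mxs /= X_orth det1 oner_neq0.
have Msym : M^T = M by rewrite /M !trmx_mul trmxK A_sym mulmxA.
have ZAX : Z^T *m A *m X = S *m M.
  by rewrite -mulmxA oja_zeroE mulmxA -Ssym trmx_mul trmxK.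
have XAZ : X^T *m A *m Z = M *m S by rewrite oja_zero_trE -mulmxA.
have XjacZ : X^T *m oja_jac Z = - (S *m M) *+ 2.
  rewrite /oja_jac ZAX XAZ mulmxBr mulmxA XAZ !mulmxDr.
  rewrite !(mulmxA X^T) X_orth !mul1mx -/S.
  by rewrite addrA opprD addrC addrNK mulr2n opprD.
have skewZ : skew (- (S *m M) *+ 2) = M *m S - S *m M.
  rewrite -scaler_nat /skew linearZ/= -scalerBr scalerA mulVf ?pnatr_eq0// scale1r.
  by rewrite linearN/= trmx_mul Msym Ssym opprK addrC.
have S0 : S = 0.
  apply: (sylvester_sym_eq0 Mpos) => //; apply/eqP; rewrite addr_eq0.
  move/(congr1 (mulmx X^T)): jacZ; rewrite mulmxA X_orth mul1mx XjacZ skewZ.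
  by move/eqP; rewrite eq_sym subr_eq mulr2n addrNK => /eqP ->.
have AZ : A *m Z = Z *m M.
  move: jacZ; rewrite XjacZ S0 mul0mx oppr0 mul0rn skew_sym ?trmx0// mulmx0.
  rewrite /oja_jac ZAX XAZ S0 mulmx0 mul0mx addr0 mulmx0 addr0 => /eqP.
  by rewrite subr_eq0 => /eqP.
suff ZX0 : Z *m X^T = 0 by rewrite -[Z]mulmx1 -X_orth mulmxA ZX0 mul0mx.
apply: (simple_spectrum_comm_nilp lam_inj lam_eig).
  by rewrite -[RHS]mulmxA oja_zero_trE [LHS]mulmxA [RHS]mulmxA AZ.
by rewrite -mulmxA [X^T *m _]mulmxA -/S S0 mul0mx mulmx0.
Qed.

End Oja.

Theorem mainTheorem2 (R : realType) (n p : nat) (p_gt0 : (0 < p)%N)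
    (ltpn : (p < n)%N) (A : 'M[R]_n) (A_sym : A^T = A) (A_pos : posdefmx A)
    (lam : 'I_n -> R)
    (lam_eig : char_poly A = \prod_(i < n) ('X - (lam i)%:P))
    (lam_decr : forall i j : 'I_n, (i < j)%N -> lam j < lam i)
    (X : 'M[R]_(n, p)) (X_full : fullrank_mxs X) (X_zero : oja_lift A X = 0) :
  nonsingular_on (hspace X) (fun Z => hproj X ('D_Z (oja_lift A) X)).
Proof.
have lam_inj : injective lam.
  move=> i j eq_lam; apply/val_inj; case: (ltngtP i j) => // /lam_decr.
    by rewrite eq_lam ltxx.
  by rewrite eq_lam ltxx.
have eig i : eigenvalue A (lam i).
  rewrite eigenvalue_root_char lam_eig; apply/rootP.
  by rewrite (bigD1 i)//= hornerM hornerXsubC subrr mul0r.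
have [X_orth FX0] := oja_lift_zero A_sym A_pos X_full X_zero.
under eq_fun do rewrite hproj_derive//.
split=> [a Z W _ _|]; first exact: (linearP (hproj X \o oja_jac A X)).
apply: (@proj_inj_bij _ _ (hproj X) (hproj X \o oja_jac A X)) => [Z|Z|Z PZ].
- exact: hproj_id.
- exact: hproj_id.
- exact: (oja_jac_inj A_sym A_pos X_orth FX0 lam_inj eig).
Qed.
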